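(* Let $G$ be a strongly regular graph with parameters $(n,k,\lambda,\mu)$ and adjacency matrix $$M=\begin{pmatrix} M_{11} & M_{12}\\ M_{21} & M_{22}\end{pmatrix},$$ where the vertices are ordered so that $M_{11}$ is the adjacency matrix of an induced subgraph $H$ of $G$. Let $P_{11}$ be the permutation matrix of a Seidel automorphism of $H$, and let $$P=\begin{pmatrix} P_{11} & 0\\ 0 & I\end{pmatrix}.$$ Then the matrix $$PMP=\begin{pmatrix} M_{11} & P_{11}M_{12}\\ M_{21}P_{11} & M_{22}\end{pmatrix}$$ is the adjacency matrix of a strongly regular graph with the same parameters $(n,k,\lambda,\mu)$.
   Context: A strongly regular graph with parameters $(n,k,\lambda,\mu)$ is a $k$-regular graph on $n$ vertices in which any two distinct adjacent vertices have exactly $\lambda$ common neighbours and any two distinct non-adjacent vertices have exactly $\mu$ common neighbours. A Seidel automorphism of a graph is an involutive automorphism $\varphi$ (i.e. $\varphi^2=\mathrm{id}$, $\varphi\neq\mathrm{id}$) that interchanges only non-adjacent vertices, i.e. for every vertex $v$ with $\varphi(v)\neq v$, the vertices $v$ and $\varphi(v)$ are non-adjacent. Its permutation matrix $P_{11}$ has $(P_{11})_{u,v}=1$ iff $v=\varphi(u)$. *)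

(* Defs.v *)
From HB Require Import structures.
From mathcomp Require Import all_boot all_order all_fingroup all_algebra.

Set Implicit Arguments.
Unset Strict Implicit.
Unset Printing Implicit Defensive.

Import GRing.Theory.
Local Open Scope ring_scope.

Record sgraph (T : finType) := SGraph {
  adj : rel T;
  adj_sym : symmetric adj;
  adj_irr : irreflexive adj
}.

Definition neighbours (T : finType) (G : sgraph T) (x : T) : {set T} :=
  [set y | adj G x y].

Definition strongly_regular (T : finType) (G : sgraph T) (n k l mu : nat) :
    Prop :=
  [/\ #|T| = n,
      forall x, #|neighbours G x| = k,
      forall x y, x != y -> adj G x y ->
        #|neighbours G x :&: neighbours G y| = l
    & forall x y, x != y -> ~~ adj G x y ->
        #|neighbours G x :&: neighbours G y| = mu].

Section Induced.
Variables (T : finType) (G : sgraph T) (S : {set T}).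

Definition induced_adj : rel {x : T | x \in S} :=
  fun x y => adj G (val x) (val y).

Lemma induced_sym : symmetric induced_adj.
Proof. by move=> x y; apply: adj_sym. Qed.

Lemma induced_irr : irreflexive induced_adj.
Proof. by move=> x; apply: adj_irr. Qed.

Definition induced : sgraph {x : T | x \in S} :=
  SGraph induced_sym induced_irr.
End Induced.

Definition automorphism (T : finType) (G : sgraph T) (phi : {perm T}) : Prop :=
  forall x y, adj G (phi x) (phi y) = adj G x y.

Definition seidel_automorphism (T : finType) (G : sgraph T) (phi : {perm T}) :
    Prop :=
  [/\ automorphism G phi,
      involutive phi,
      phi <> 1%g
    & forall x, phi x <> x -> ~~ adj G x (phi x)].

(* Matrices are taken relative to an ordering v of the vertices, which is
   meant to be a bijection. *)
Definition adjmx (R : nzRingType) (T : finType) (n : nat) (v : 'I_n -> T)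
    (G : sgraph T) : 'M[R]_n :=
  \matrix_(i, j) (adj G (v i) (v j))%:R.

Definition permmx (R : nzRingType) (T : finType) (n : nat) (v : 'I_n -> T)
    (phi : {perm T}) : 'M[R]_n :=
  \matrix_(i, j) (v j == phi (v i))%:R.

(* Main.v *)
(** Extend the Seidel automorphism [phi] of [H] by the identity to an
    involution [psi] of all the vertices.  Then [P] is the permutation matrix
    of [psi], so [PMP] is the adjacency matrix of the graph obtained from [G]
    by relabelling the vertices along [psi], which is isomorphic to [G].  The
    same computation inside [H] gives [P11 M11 P11 = M11], because [phi] is an
    automorphism of [H]. *)

Require Import Defs.
From HB Require Import structures.
From mathcomp Require Import all_boot all_order all_fingroup all_algebra.

Set Implicit Arguments.
Unset Strict Implicit.
Unset Printing Implicit Defensive.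

Import GRing.Theory.
Local Open Scope ring_scope.

Section Relabel.
Variables (T : finType) (G : sgraph T) (psi : {perm T}).

Definition relabel_adj : rel T := fun x y => adj G (psi x) (psi y).

Lemma relabel_sym : symmetric relabel_adj.
Proof. by move=> x y; apply: adj_sym. Qed.

Lemma relabel_irr : irreflexive relabel_adj.
Proof. by move=> x; apply: adj_irr. Qed.

Definition relabel : sgraph T := SGraph relabel_sym relabel_irr.

Lemma neighbours_relabel x : neighbours relabel x = psi @^-1: neighbours G (psi x).
Proof. by apply/setP => y; rewrite !inE. Qed.

(** Neighbourhoods in [relabel] are preimages under the bijection [psi]. Such preimages commute with
    intersection and keep cardinality, and adjacency of [x] and [y] in [relabel] is by definition
    that of [psi x] and [psi y] in [G]. *)
Lemma strongly_regular_relabel n k l mu :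
  strongly_regular G n k l mu -> strongly_regular relabel n k l mu.
Proof.
have cardV (A : {set T}) : #|psi @^-1: A| = #|A|.
  by apply: on_card_preimset; exists psi^-1%g => x _; rewrite ?permK ?permKV.
case=> hn hk hl hmu; split=> // [x|x y nxy axy|x y nxy axy].
- by rewrite neighbours_relabel cardV.
- by rewrite !neighbours_relabel -preimsetI cardV hl // (inj_eq perm_inj).
- by rewrite !neighbours_relabel -preimsetI cardV hmu // (inj_eq perm_inj).
Qed.

Lemma mulmx_permmx_adjmx (R : nzRingType) n (v : 'I_n -> T) :
  bijective v -> involutive psi ->
  permmx R v psi *m adjmx R v G *m permmx R v psi = adjmx R v relabel.
Proof.
case=> w vK wK psiK; apply/matrixP => i j; rewrite !mxE.
(* Column [j] of the right factor has its only 1 where [psi (v a) = v j], that is [v a = psi (v j)]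
   because [psi] is an involution. *)
rewrite (bigD1 (w (psi (v j)))) //= [X in _ + X]big1 => [|a]; last first.
  rewrite !mxE => /negPf ne_a; case: eqP => [eq_a|_]; last by rewrite mulr0.
  by rewrite eq_a psiK vK eqxx in ne_a.
rewrite addr0 !mxE wK psiK eqxx mulr1.
(* Row [i] of the left factor has its only 1 where [v a = psi (v i)]. *)
rewrite (bigD1 (w (psi (v i)))) //= [X in _ + X]big1 => [|a]; last first.
  rewrite !mxE => /negPf ne_a; case: eqP => [eq_a|_]; last by rewrite mul0r.
  by rewrite -eq_a vK eqxx in ne_a.
by rewrite addr0 !mxE !wK eqxx mul1r.
Qed.

End Relabel.

Section ExtendInvolution.
Variables (T : finType) (S : {set T}) (phi : {perm {x : T | x \in S}}).
Hypothesis phiK : involutive phi.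

(** As [phi] acts on a subtype, [insub] both tests membership in [S] and supplies the element to
    which [phi] applies. *)
Definition extend_fun (x : T) : T :=
  if insub x is Some u then val (phi u) else x.

Lemma extend_fun_val u : extend_fun (val u) = val (phi u).
Proof. by rewrite /extend_fun valK. Qed.

Lemma extend_fun_id x : x \notin S -> extend_fun x = x.
Proof. by rewrite /extend_fun => xNS; rewrite insubN. Qed.

Lemma extend_funK : involutive extend_fun.
Proof.
move=> x; case: (boolP (x \in S)) => xS; last by rewrite !extend_fun_id.
by rewrite -[x]/(val (exist (fun z => z \in S) x xS)) !extend_fun_val phiK.
Qed.

Definition extend_perm : {perm T} := perm (inv_inj extend_funK).

Lemma extend_permK : involutive extend_perm.
Proof. by move=> x; rewrite !permE extend_funK. Qed.

(** The first [m1] indices enumerate exactly [S], which the extension maps to itself through [phi];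
    the remaining indices enumerate fixed points. Hence the off-diagonal blocks vanish. *)
Lemma permmx_extend (R : nzRingType) m1 m2 (v : 'I_(m1 + m2) -> T)
    (v1 : 'I_m1 -> {x : T | x \in S}) :
  bijective v -> bijective v1 ->
  (forall i, v (lshift m2 i) = val (v1 i)) ->
  permmx R v extend_perm = block_mx (permmx R v1 phi) 0 0 1%:M.
Proof.
move=> /bij_inj v_inj [w1 v1K w1K] hS.
(* Since [v1] is onto, a vertex of [S] already has a left index, and injectivity of [v] forbids a
   right one. *)
have vrS j : v (rshift m1 j) \notin S.
  apply/negP => vjS; have := hS (w1 (exist (fun z => z \in S) _ vjS)).
  by rewrite w1K => /v_inj/eqP; rewrite eq_lrshift.
rewrite -[LHS]submxK; congr block_mx; apply/matrixP => i j;
  rewrite !mxE permE.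
- by rewrite !hS extend_fun_val (inj_eq val_inj).
- rewrite !hS extend_fun_val; case: eqP => // eq_v.
  by have := vrS j; rewrite eq_v (valP (phi (v1 i))).
- by rewrite extend_fun_id // (inj_eq v_inj) eq_lrshift.
- by rewrite extend_fun_id // (inj_eq v_inj) eq_rshift eq_sym.
Qed.

End ExtendInvolution.

Theorem theorem5 (R : nzRingType) (T : finType) (G : sgraph T)
    (n k l mu : nat) (hG : strongly_regular G n k l mu)
    (S : {set T}) (m1 m2 : nat)
    (v : 'I_(m1 + m2) -> T) (v1 : 'I_m1 -> {x : T | x \in S})
    (hv : bijective v) (hv1 : bijective v1)
    (hS : forall i : 'I_m1, v (lshift m2 i) = val (v1 i))
    (M11 : 'M[R]_m1) (M12 : 'M[R]_(m1, m2))
    (M21 : 'M[R]_(m2, m1)) (M22 : 'M[R]_m2)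
    (hM : adjmx R v G = block_mx M11 M12 M21 M22)
    (phi : {perm {x : T | x \in S}})
    (hphi : seidel_automorphism (induced G S) phi) :
  let M := block_mx M11 M12 M21 M22 in
  let P11 := permmx R v1 phi in
  let P := block_mx P11 0 0 1%:M in
  P *m M *m P = block_mx M11 (P11 *m M12) (M21 *m P11) M22 /\
  exists G' : sgraph T,
    P *m M *m P = adjmx R v G' /\ strongly_regular G' n k l mu.
Proof.
case: hphi => phi_aut phiK _ _.
have M11E : M11 = adjmx R v1 (induced G S).
  rewrite -(block_mxKul M11 M12 M21 M22) -hM.
  by apply/matrixP => i j; rewrite !mxE !hS.
move=> M P11 P; split.
  rewrite !mulmx_block !(mul0mx, mulmx0, mul1mx, mulmx1, addr0, add0r).
  (* Only the upper left block is not settled by block multiplication. *)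
  congr block_mx; rewrite M11E mulmx_permmx_adjmx //.
  by apply/matrixP => i j; rewrite !mxE [adj _ _ _]phi_aut.
exists (relabel G (extend_perm phiK)); split; last first.
  exact: strongly_regular_relabel.
rewrite /P /M -(permmx_extend phiK R hv hv1 hS) -hM.
by apply: mulmx_permmx_adjmx => //; apply: extend_permK.
Qed.
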